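(* Let $X\subset\mathbb{P}^N$ be an irreducible projective variety of dimension $n\geq 1$ with $n\leq N/2$, such that $X\cap\Delta_{N-n-1}=\emptyset$. Then $\operatorname{Hrk}_X(p)\leq N$ for every $p\in\mathbb{P}^N$.
   Context: Work in $\mathbb{P}^N$ over $\mathbb{C}$ with fixed coordinates. For $p=(p_0:\cdots:p_N)$, $q=(q_0:\cdots:q_N)$, the Hadamard product $p\star q=(p_0q_0:\cdots:p_Nq_N)$ is defined whenever not all $p_iq_i$ are zero. The Hadamard-$X$-rank of $q$ is $\operatorname{Hrk}_X(q)=\min\{m\mid q=p_1\star\cdots\star p_m,\ p_i\in X\}$, or $\infty$ if no such decomposition exists. For $0\le i\le N$, $\Delta_i\subset\mathbb{P}^N$ is the set of points with at most $i+1$ nonzero coordinates; thus $\Delta_{N-k}$ is the set of points with at least $k$ coordinates equal to zero. *)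

(* Defs.v *)
From HB Require Import structures.
From mathcomp Require Import all_boot all_order all_algebra.
From mathcomp Require Import mpoly.
From mathcomp Require Import complex.
From mathcomp Require Import Rstruct.
Set Implicit Arguments.
Unset Strict Implicit.
Unset Printing Implicit Defensive.
Import Order.TTheory GRing.Theory Num.Theory.
Local Open Scope ring_scope.

Definition C : closedFieldType := (Rdefinitions.R)[i].

(* Homogeneous coordinate vectors of P^N : functions 'I_N.+1 -> C.
   A point of P^N is a nonzero vector up to nonzero scaling; subsets of P^N
   are represented by scaling-invariant predicates on nonzero vectors. *)
Definition coords (N : nat) := 'I_N.+1 -> C.

Definition nonzero_vec (N : nat) (v : coords N) : Prop := exists i, v i != 0.

Definition proj_eq (N : nat) (v w : coords N) : Prop :=
  nonzero_vec v /\ exists c : C, c != 0 /\ forall i, v i = c * w i.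

Definition homogeneous (N : nat) (f : {mpoly C[N.+1]}) : Prop :=
  exists d : nat, forall m, m \in msupp f -> mdeg m = d.

Definition proj_closed (N : nat) (X : coords N -> Prop) : Prop :=
  exists S : {mpoly C[N.+1]} -> Prop,
    (forall f, S f -> homogeneous f) /\
    forall v, X v <-> (nonzero_vec v /\ forall f, S f -> f.@[v] = 0).

Definition subset_of (N : nat) (X Y : coords N -> Prop) : Prop :=
  forall v, X v -> Y v.

Definition proj_irreducible (N : nat) (X : coords N -> Prop) : Prop :=
  proj_closed X /\ (exists v, X v) /\
  forall Y Z : coords N -> Prop, proj_closed Y -> proj_closed Z ->
    subset_of X (fun v => Y v \/ Z v) -> subset_of X Y \/ subset_of X Z.

Definition strict_subset (N : nat) (X Y : coords N -> Prop) : Prop :=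
  subset_of X Y /\ ~ subset_of Y X.

Definition irr_chain_in (N : nat) (X : coords N -> Prop) (k : nat)
    (Ch : nat -> coords N -> Prop) : Prop :=
  (forall j, (j <= k)%N -> proj_irreducible (Ch j) /\ subset_of (Ch j) X) /\
  (forall j, (j < k)%N -> strict_subset (Ch j) (Ch j.+1)).

Definition proj_dim (N : nat) (X : coords N -> Prop) (n : nat) : Prop :=
  (exists Ch, irr_chain_in X n Ch) /\ ~ (exists Ch, irr_chain_in X n.+1 Ch).

Definition irr_proj_variety (N : nat) (X : coords N -> Prop) (n : nat) : Prop :=
  proj_irreducible X /\ proj_dim X n.

Definition Delta (N i : nat) (v : coords N) : Prop :=
  nonzero_vec v /\ (#|[set j : 'I_N.+1 | v j != 0%R]| <= i.+1)%N.

Definition hadamard (N m : nat) (p : 'I_m -> coords N) : coords N :=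
  fun i => \prod_(j < m) p j i.

Definition Hrk_le (N : nat) (X : coords N -> Prop) (q : coords N) (r : nat) : Prop :=
  exists m : nat, (1 <= m)%N /\ (m <= r)%N /\
    exists p : 'I_m -> coords N, (forall j, X (p j)) /\ proj_eq q (hadamard p).

(* Main.v *)
Require Import Defs.
From HB Require Import structures.
From mathcomp Require Import all_boot all_order all_algebra.
From mathcomp Require Import mpoly.
From mathcomp Require Import complex Rstruct.
From mathcomp Require Import ring lra zify.
From Stdlib Require Import Classical ClassicalEpsilon.
Local Open Scope ring_scope.
Set Implicit Arguments.
Unset Strict Implicit.
Unset Printing Implicit Defensive.
Import Order.TTheory GRing.Theory Num.Theory.

(** Dimension is measured by growth of Hilbert functions: a chain of [n + 1]
irreducible closed sets forces at least [c t^n] independent forms of degree [t],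
whereas [k] forms without common zero on [Z] make the coordinate ring of [Z]
finite over [k] generators (Nullstellensatz), so that only [O(t^(k-1))] forms of
degree [t] are independent on [Z]. Hence [k] forms always have a common zero on a
set whose Hilbert function grows like [t^k].

Cutting [X] by the elementary symmetric polynomials of degrees [N - 1], ...,
[N - n + 1] gives a curve [Y]: a point with exactly [z] zero coordinates has
nonzero [e_(N+1-z)], so that points of [Y] have at most one zero coordinate, and
by the above the ratio of two coordinates takes all values on [Y]. The [N]-fold
Segre product of [Y] thus has a Hilbert function at least [(t+1)^N]. A point [q]
is given by [N] linear equations in the diagonal Segre coordinates, which are the
coordinates of the Hadamard product; their common zero yields [N] points of [Y]
whose product is [q], as this product has at most [N] zero coordinates. *)

(** * Nullstellensatz over an uncountable algebraically closed field *)

Definition uncountable (T : eqType) :=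
  forall L : nat -> seq T, exists x, forall m, x \notin L m.

Definition is_ideal (R : comNzRingType) (I : R -> Prop) :=
  [/\ I 0, forall x y, I x -> I y -> I (x + y) & forall x y, I y -> I (x * y)].

Lemma uncountable_avoid (T : eqType) (s : seq T) :
  uncountable T -> exists x, x \notin s.
Proof. by move=> /(_ (fun=> s)) [x /(_ 0%N)]; exists x. Qed.

(** Otherwise each [Q i] would hold only on a finite set, and these countably many finite sets would
    cover [T]. *)
Lemma uncountable_pigeonhole (T : eqType) (I : countType)
    (Q : I -> T -> Prop) :
  uncountable T -> (forall a, exists i, Q i a) ->
  exists i, forall B, exists s : B.-tuple T, uniq s /\ forall a, a \in s -> Q i a.
Proof.
move=> uncT Q_all.
case: (classic (exists i, forall L : seq T, exists a, Q i a /\ a \notin L)).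
  case=> i infQ; exists i; elim=> [|B [s [uniq_s Qs]]].
    by exists [tuple].
  have [a [Qa a_notin]] := infQ s.
  exists [tuple of a :: s]; split=> [|b]; first by rewrite /= a_notin.
  by rewrite inE => /predU1P[->|/Qs].
move=> no_inf; exfalso.
have /ClassicalEpsilon.choice [L coverL] :
    forall i, exists L : seq T, forall a, Q i a -> a \in L.
  move=> i; apply: NNPP => noL; apply: no_inf; exists i => L.
  apply: NNPP => noa; apply: noL; exists L => a Qa.
  by apply: contraT => a_notin; case: noa; exists a.
have [a a_notin] := uncT (fun m => if @unpickle I m is Some i then L i else [::]).
have [i /coverL a_in] := Q_all a.
by have := a_notin (pickle i); rewrite pickleK a_in.
Qed.

Lemma row_dependence (F : fieldType) (m n : nat) (A : 'M[F]_(m, n)) :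
  (n < m)%N -> exists2 c : 'rV_m, c != 0 & c *m A = 0.
Proof.
move=> lt_nm.
have: kermx A != 0.
  by rewrite -mxrank_eq0 mxrank_ker -lt0n subn_gt0 (leq_ltn_trans (rank_leq_col A)).
by case/rowV0Pn=> c /sub_kermxP cA0 c_neq0; exists c.
Qed.

Lemma mpoly_dependence (F : fieldType) (r d M : nat) (h : 'I_M -> {mpoly F[r]}) :
  (forall i, msize (h i) <= d)%N -> (#|{: 'X_{1..r < d}}| < M)%N ->
  exists c : 'I_M -> F, (exists i, c i != 0) /\ \sum_i c i *: h i = 0.
Proof.
move=> size_h ltM.
pose A := \matrix_(i < M, j < #|{: 'X_{1..r < d}}|) (h i)@_(enum_val j).
have [c c_neq0 cA0] := row_dependence A ltM.
exists (c 0); split.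
  by have /rV0Pn := c_neq0.
apply/mpolyP => m; rewrite mcoeff0 raddf_sum /=.
case: (ltnP (mdeg m) d) => [lt_md|le_dm].
  have := congr1 (fun M : 'rV_ _ => M 0 (enum_rank (BMultinom lt_md))) cA0.
  rewrite !mxE => {2}<-; apply: eq_bigr => i _.
  by rewrite !mxE enum_rankK mcoeffZ.
rewrite big1 // => i _; rewrite mcoeffZ memN_msupp_eq0 ?mulr0 //.
apply: contraL le_dm => /msize_mdeg_lt lt_m; rewrite -ltnNge.
exact: leq_trans lt_m (size_h i).
Qed.

Lemma mpoly_ring_ind (R : comNzRingType) (r : nat) (P : {mpoly R[r]} -> Prop) :
  (forall c, P c%:MP) -> (forall i, P 'X_i) ->
  (forall f g, P f -> P g -> P (f + g)) ->
  (forall f g, P f -> P g -> P (f * g)) -> forall f, P f.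
Proof.
move=> Pc PX PD PM f; rewrite [f]mpolyE.
elim/big_ind: _ => [|f1 f2|m _]; first exact: (Pc 0); first exact: PD.
rewrite -mul_mpolyC; apply: (PM) => //; rewrite mpolyXE_id.
elim/big_ind: _ => [|f1 f2|i _]; first exact: (Pc 1); first exact: PM.
by elim: (m i) => [|k IHk]; [exact: (Pc 1) | rewrite exprS; apply: (PM)].
Qed.

Definition ideal_adjoin (R : comNzRingType) (I : R -> Prop) (y f : R) :=
  exists h, I (f - y * h).

Lemma ideal_adjoin_is_ideal (R : comNzRingType) (I : R -> Prop) (y : R) :
  is_ideal I -> is_ideal (ideal_adjoin I y).
Proof.
case=> I0 ID IM; split=> [|f g [h If] [k Ig]|f g [k Ig]].
- by exists 0; rewrite mulr0 subr0.
- by exists (h + k); rewrite mulrDr opprD addrACA; apply: ID.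
- by exists (f * k); rewrite mulrCA -mulrBr; apply: IM.
Qed.

Lemma ideal_adjoin_sub (R : comNzRingType) (I : R -> Prop) (y f : R) :
  I f -> ideal_adjoin I y f.
Proof. by exists 0; rewrite mulr0 subr0. Qed.

Lemma ideal_adjoin_gen (R : comNzRingType) (I : R -> Prop) (y : R) :
  is_ideal I -> ideal_adjoin I y y.
Proof. by case=> I0 _ _; exists 1; rewrite mulr1 subrr. Qed.

(** Factors are removed one by one: a relation [w ^+ e1 = y a * h] modulo [I] trades the factor
    [y a] for a higher power of [w]. *)
Lemma ideal_split (R : comNzRingType) (I : R -> Prop) (w x : R)
    (T : Type) (y : T -> R) :
  is_ideal I -> (forall a, exists e, ideal_adjoin I (y a) (w ^+ e)) ->
  forall (s : seq T) e, I (w ^+ e * \prod_(a <- s) y a) -> exists e', I (w ^+ e').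
Proof.
move=> [I0 ID IM] inv; elim=> [|a s IHs] e.
  by rewrite big_nil mulr1; exists e.
rewrite big_cons; set P := \prod_(_ <- s) _ => IwP.
have [e1 [h Ih]] := inv a.
apply: (IHs (e + e1)%N); rewrite -/P.
have := ID _ _ (IM (w ^+ e * P) _ Ih) (IM h _ IwP).
by congr I; rewrite exprD; ring.
Qed.

(* If every [a] made some power of [w] lie in [I + ('X_j - a)], uncountably many
   [a] would share the exponent [e] and a degree bound for the multiplier [h a]; a
   linear dependence between the [h a] puts [w ^+ e * p('X_j)] in [I] with [p != 0],
   and the linear factors of [p] divide powers of [w] modulo [I]. *)
Lemma nullstellensatz_step (F : closedFieldType) (r : nat)
    (I : {mpoly F[r]} -> Prop) (w : {mpoly F[r]}) (j : 'I_r) :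
  uncountable F -> is_ideal I -> (forall e, ~ I (w ^+ e)) ->
  exists a, forall e, ~ ideal_adjoin I ('X_j - a%:MP) (w ^+ e).
Proof.
move=> uncF idI wI; apply: NNPP => no_a.
pose y (a : F) : {mpoly F[r]} := 'X_j - a%:MP.
have inv a : exists e, ideal_adjoin I (y a) (w ^+ e).
  by apply: NNPP => no_e; apply: no_a; exists a => e Iwe; apply: no_e; exists e.
have [I0 ID IM] := idI.
pose Q (ed : nat * nat) a :=
  exists h, (msize h <= ed.2)%N /\ I (w ^+ ed.1 - y a * h).
have [a|[e d] many] := uncountable_pigeonhole (Q := Q) uncF.
  by have [e [h Ih]] := inv a; exists (e, msize h), h.
have [s [uniq_s Qs]] := many #|{: 'X_{1..r < d}}|.+1.
have /tuple_uniqP inj_s := uniq_s.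
have {Qs}Qs (i : 'I_#|{: 'X_{1..r < d}}|.+1) := Qs _ (mem_tnth i s).
have /fin_all_exists [h hP] := Qs; rewrite /= in hP.
have [i|c [[i0 ci0] ch0]] := mpoly_dependence (h := h) (d := d) _ (ltnSn _).
  by have [] := hP i.
(* At the point [tnth s i0] only the summand [c i0 *: q i0] of [p] survives; since the points are
   distinct and [c i0 != 0], so is [p]. *)
pose q i : {poly F} := \prod_(l | l != i) ('X - (tnth s l)%:P).
pose p := \sum_i c i *: q i.
pose ev : {rmorphism {poly F} -> {mpoly F[r]}} := horner_alg ('X_j : {mpoly F[r]}).
have evX a : ev ('X - a%:P) = y a.
  by rewrite rmorphB /= /ev /= horner_algX horner_algC /y alg_mpolyC.
have evZ a f : ev (a *: f) = a *: ev f.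
  by rewrite -mul_polyC rmorphM /= horner_algC mulr_algl.
have p_neq0 : p != 0.
  apply: contraNneq ci0 => p0.
  have := congr1 (fun f : {poly F} => f.[tnth s i0]) p0.
  rewrite horner0 horner_sum (bigD1 i0) //= big1 ?addr0 => [|i ni].
    rewrite hornerZ horner_prod => /eqP; rewrite mulf_eq0 => /orP[//|].
    case/prodf_eq0 => l nl; rewrite !hornerE subr_eq0 => /eqP/inj_s eq_il.
    by rewrite eq_il eqxx in nl.
  by rewrite hornerZ horner_prod (bigD1 i0) 1?eq_sym //= hornerXsubC subrr mul0r mulr0.
(* Each [ev (q i) * y (tnth s i)] is the same full product, so the terms in [h i] add up to a
   multiple of the vanishing sum of the [c i *: h i]. *)
have Iwp : I (w ^+ e * ev p).
  have -> : w ^+ e * ev p =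
      \sum_i (c i *: ev (q i)) * (w ^+ e - y (tnth s i) * h i).
    under [RHS]eq_bigr => i _ do rewrite mulrBr.
    rewrite sumrB [X in _ - X](_ : _ = 0) ?subr0.
      rewrite rmorph_sum mulr_sumr; apply: eq_bigr => i _.
      by rewrite evZ mulrC.
    transitivity (\sum_i (\prod_l y (tnth s l)) * (c i *: h i)).
      apply: eq_bigr => i _; rewrite mulrA -[X in X * _ = _]scalerAl.
      rewrite (bigD1 i) //= rmorph_prod /=.
      under eq_bigr => l _ do rewrite evX.
      by rewrite -scalerAl -scalerAr [y _ * _]mulrC.
    by rewrite -mulr_sumr ch0 mulr0.
  elim/big_ind: _ => // i _; apply: IM; by have [] := hP i.
have [rs def_p] := closed_field_poly_normal p.
have [|e1 Iwe1] := @ideal_split _ I w 0 F y idI inv rs e.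
  have := IM ((lead_coef p)^-1)%:MP _ Iwp; congr I.
  rewrite {2}def_p evZ rmorph_prod /=.
  under eq_bigr => l _ do rewrite evX.
  rewrite mul_mpolyC -scalerAr scalerA mulVf ?scale1r //.
  by rewrite lead_coef_eq0.
exact: wI Iwe1.
Qed.

(** If no power of [w] is in [I], adjoining one ['X_j - a] after another keeps it so and ends with
    an ideal [J] modulo which every polynomial equals its value at a point [v]. As [1] is not in
    [J], [v] is a zero of [I]; then [w.@[v] = 0] puts [w] in [J], a contradiction. *)
Theorem nullstellensatz (F : closedFieldType) (r : nat)
    (I : {mpoly F[r]} -> Prop) (w : {mpoly F[r]}) :
  uncountable F -> is_ideal I ->
  (forall v : 'I_r -> F, (forall f, I f -> f.@[v] = 0) -> w.@[v] = 0) ->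
  exists e, I (w ^+ e).
Proof.
move=> uncF idI w0; apply: NNPP => no_e.
have step k : (k <= r)%N -> exists J : {mpoly F[r]} -> Prop,
    [/\ is_ideal J, forall f, I f -> J f, forall e, ~ J (w ^+ e) &
        forall j : 'I_r, (j < k)%N -> exists a, J ('X_j - a%:MP)].
  elim: k => [_|k IHk lt_kr].
    by exists I; split=> // e Ie; apply: no_e; exists e.
  have [J [idJ IJ wJ JX]] := IHk (ltnW lt_kr).
  have [a aP] := nullstellensatz_step (Ordinal lt_kr) uncF idJ wJ.
  exists (ideal_adjoin J ('X_(Ordinal lt_kr) - a%:MP)); split=> //.
  - exact: ideal_adjoin_is_ideal.
  - by move=> f /IJ/ideal_adjoin_sub.
  move=> j; rewrite ltnS leq_eqVlt => /orP[/eqP eq_jk|/JX[b Jb]].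
    by exists a; rewrite (_ : j = Ordinal lt_kr); [apply: ideal_adjoin_gen | apply: val_inj].
  by exists b; apply: ideal_adjoin_sub.
have [J [[J0 JD JM] IJ wJ JX]] := step r (leqnn r).
have /fin_all_exists [v vP] : forall j, exists a, J ('X_j - a%:MP).
  by move=> j; apply: JX.
have Jv : forall f, J (f - f.@[v]%:MP).
  elim/mpoly_ring_ind => [c|i|f g Jf Jg|f g Jf Jg].
  - by rewrite mevalC subrr.
  - by rewrite mevalXU.
  - by rewrite mevalD mpolyCD opprD addrACA; apply: JD.
  rewrite mevalM mpolyCM.
  have := JD _ _ (JM g _ Jf) (JM f.@[v]%:MP _ Jg); congr J; ring.
have := wJ 1%N; rewrite expr1; apply.
have := Jv w; rewrite (w0 v) ?mpolyC0 ?subr0 // => f If.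
apply/eqP; apply: contraT => fv; case: (wJ 0%N); rewrite expr0.
have := JD _ _ (JM (- (f.@[v]^-1)%:MP) _ (Jv f)) (JM (f.@[v]^-1)%:MP _ (IJ _ If)).
congr J; rewrite mulNr mulrBr -mpolyCM mulVf // mpolyC1; ring.
Qed.

(** * Hilbert functions and common zeros *)

(** A lower bound for the dimension of the degree [t] part of the homogeneous coordinate ring of
    [Z], without forming the quotient. *)
Definition hilbert_ge (F : fieldType) (r : nat) (Z : ('I_r -> F) -> Prop)
    (t M : nat) :=
  exists f : 'I_M -> {mpoly F[r]}, (forall i, f i \is t.-homog) /\
    forall c : 'I_M -> F,
      (forall v, Z v -> \sum_i c i * (f i).@[v] = 0) -> forall i, c i = 0.

(** The Zariski closure of the cone over [Z], as cut out by forms. The zero vector can belong to it,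
    hence the separate nonvanishing conditions below. *)
Definition homog_closure (F : fieldType) (r : nat) (Z : ('I_r -> F) -> Prop)
    (u : 'I_r -> F) :=
  forall d (f : {mpoly F[r]}), f \is d.-homog ->
    (forall v, Z v -> f.@[v] = 0) -> f.@[u] = 0.

Lemma pihomogMXU (R : comNzRingType) (r : nat) (d : nat) (i : 'I_r)
    (f : {mpoly R[r]}) :
  pihomog mdeg d.+1 ('X_i * f) = 'X_i * pihomog mdeg d f.
Proof.
rewrite {1}[f]mpolyE [in RHS]pihomogE mulr_sumr raddf_sum /= mulr_sumr [RHS]big_mkcond /=.
apply: eq_bigr => m _; rewrite -scalerAr linearZ /= -mpolyXD pihomogX /= mdegD mdeg1.
by rewrite add1n eqSS; case: ifP => _; rewrite ?scaler0 // mpolyXD scalerAr.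
Qed.

Lemma pihomog0MXU (R : comNzRingType) (r : nat) (i : 'I_r) (f : {mpoly R[r]}) :
  pihomog mdeg 0 ('X_i * f) = 0.
Proof.
rewrite [f]mpolyE mulr_sumr raddf_sum /= big1 // => m _.
by rewrite -scalerAr linearZ /= -mpolyXD pihomogX /= mdegD mdeg1 scaler0.
Qed.

(** * Reduction of forms on [Z] modulo the forms [G] *)

Section Reduction.
Context (F : fieldType) (r k D : nat) (Z : ('I_r -> F) -> Prop)
  (G : 'I_k -> {mpoly F[r]}).

(* Multiplier forms have degree [t - D]; as the subtraction is truncated, they
   are required to vanish when [t < D]. *)
Definition reduces (t : nat) (f : {mpoly F[r]}) :=
  exists g : 'I_k -> {mpoly F[r]},
    (forall l, g l \is (t - D).-homog /\ ((t < D)%N -> g l = 0)) /\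
    forall v, Z v -> f.@[v] = \sum_l (G l).@[v] * (g l).@[v].

Lemma reduces0 t f : (forall v, Z v -> f.@[v] = 0) -> reduces t f.
Proof.
move=> f0; exists (fun=> 0); split=> [l|v Zv]; first by split; rewrite ?rpred0.
by rewrite f0 // big1 // => l _; rewrite meval0 mulr0.
Qed.

Lemma reducesD t f1 f2 : reduces t f1 -> reduces t f2 -> reduces t (f1 + f2).
Proof.
case=> [g1 [h1 e1]] [g2 [h2 e2]]; exists (fun l => g1 l + g2 l); split=> [l|v Zv].
  have [[? z1] [? z2]] := (h1 l, h2 l); split; first exact: rpredD.
  by move=> lt; rewrite z1 ?z2 ?addr0.
rewrite mevalD e1 ?e2 // -big_split; apply: eq_bigr => l _.
by rewrite mevalD mulrDr.
Qed.

Lemma reducesM e h t f :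
  h \is e.-homog -> reduces t f -> reduces (e + t) (h * f).
Proof.
move=> hom_h [g [hg eg]]; exists (fun l => h * g l); split=> [l|v Zv].
  have [hom_g g0] := hg l; have [le_Dt|/g0 ->] := leqP D t.
    split; last by rewrite ltnNge (leq_trans le_Dt) ?leq_addl.
    by rewrite -addnBA // dhomogM.
  by rewrite mulr0; split=> //; rewrite rpred0.
rewrite mevalM eg // mulr_sumr; apply: eq_bigr => l _.
by rewrite mevalM mulrCA.
Qed.

Lemma reducesZ t c f : reduces t f -> reduces t (c *: f).
Proof.
rewrite -mul_mpolyC -{2}[t]add0n; apply: reducesM.
by rewrite -[c%:MP]mulr1 mul_mpolyC rpredZ // dhomog1.
Qed.

Lemma reduces_sum (I : Type) t (s : seq I) (P : pred I) f :
  (forall i, P i -> reduces t (f i)) -> reduces t (\sum_(i <- s | P i) f i).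
Proof.
move=> redf; elim/big_ind: _ => //; last exact: reducesD.
by apply: reduces0 => v _; rewrite meval0.
Qed.

(** For forms [G] of degree [D], this is the ideal generated by [G] and by the forms vanishing on
    [Z]; the componentwise definition gives the multipliers their degrees. *)
Definition reduction_ideal (f : {mpoly F[r]}) :=
  forall d, reduces d (pihomog mdeg d f).

Lemma reduction_ideal_is_ideal : is_ideal reduction_ideal.
Proof.
split=> [d|f g If Ig d|].
- by rewrite pihomog0; apply: reduces0 => v _; rewrite meval0.
- by rewrite pihomogD; apply: reducesD.
elim/mpoly_ring_ind => [c|i|f g IHf IHg|f g IHf IHg] h Ih.
- by move=> d; rewrite mul_mpolyC linearZ /=; apply: reducesZ.
- case=> [|d]; last by rewrite pihomogMXU -add1n; apply: reducesM; [rewrite dhomogX /= mdeg1|exact: Ih].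
  by rewrite pihomog0MXU; apply: reduces0 => v _; rewrite meval0.
- by move=> d; rewrite mulrDl pihomogD; apply: reducesD; [apply: IHf|apply: IHg].
by rewrite -mulrA; apply: IHf; apply: IHg.
Qed.

Lemma reduction_ideal_homog d f :
  f \is d.-homog -> reduces d f -> reduction_ideal f.
Proof.
move=> hom_f red_f e; have [<-|ne_de] := eqVneq d e; first by rewrite pihomog_dE.
by rewrite (pihomog_ne0 ne_de) //; apply: reduces0 => v _; rewrite meval0.
Qed.

Hypothesis homG : forall l, G l \is D.-homog.

Lemma reduces_gen l : reduces D (G l).
Proof.
exists (fun i => if i == l then 1 else 0); split=> [i|v Zv].
  by rewrite subnn ltnn; split=> //; case: ifP; rewrite ?rpred0 ?dhomog1.
rewrite (bigD1 l) //= eqxx meval1 mulr1 big1 ?addr0 // => i /negPf ->.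
by rewrite meval0 mulr0.
Qed.

End Reduction.

(** The Nullstellensatz makes a power of every variable reducible, and a monomial of large degree is
    divisible by one of these powers. *)
Lemma reduces_of_no_zero (F : closedFieldType) (r k D : nat)
    (Z : ('I_r -> F) -> Prop) (G : 'I_k -> {mpoly F[r]}) :
  uncountable F -> (forall l, G l \is D.-homog) -> (0 < D)%N ->
  (forall u, homog_closure Z u -> (forall l, (G l).@[u] = 0) -> forall i, u i = 0) ->
  exists t0, (D <= t0)%N /\
    forall t f, (t0 <= t)%N -> f \is t.-homog -> reduces D Z G t f.
Proof.
move=> uncF homG D_gt0 no_zero.
have idJ := @reduction_ideal_is_ideal _ _ _ D Z G.
have /fin_all_exists [e eP] : forall i : 'I_r,
    exists e, reduces D Z G e ('X_i ^+ e).
  move=> i; have [u Ju|e /(_ e)] := nullstellensatz (w := 'X_i) uncF idJ.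
    rewrite mevalXU; apply: no_zero => [d f hom_f f0|l].
      exact/Ju/(reduction_ideal_homog hom_f)/reduces0.
    exact/Ju/(reduction_ideal_homog (homG l))/reduces_gen.
  rewrite pihomog_dE; first by exists e.
  by rewrite mpolyXn dhomogX /= mdegMn mdeg1 mul1n.
(* The summand [D > 0] makes the degree exceed the sum of the [e i], so some exponent of the
   monomial reaches its [e i]. *)
exists (D + \sum_i e i)%N; split=> [|t f le_t hom_f]; first exact: leq_addr.
rewrite [f]mpolyE big_seq; apply: reduces_sum => m m_f; apply: reducesZ.
have deg_m := dhomog_mf hom_f m_f; rewrite /= in deg_m.
have [i le_ei] : exists i, (e i <= m i)%N.
  apply/existsP; rewrite -[[exists i, _]]negbK negb_exists; apply/negP => /forallP lt_me.
  have: (mdeg m <= \sum_i e i)%N.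
    rewrite mdegE; apply: leq_sum => i _.
    by have := lt_me i; rewrite -ltnNge => /ltnW.
  rewrite deg_m => /(leq_trans le_t).
  by rewrite -[X in (_ <= X)%N]add0n leq_add2r leqNgt D_gt0.
have le_em : (U_(i) *+ e i <= m)%MM.
  apply/mnm_lepP => j; rewrite mulmnE mnm1E; by case: eqP => [<-|_]; rewrite ?mul1n.
have -> : t = (mdeg (m - U_(i) *+ e i) + e i)%N.
  by rewrite -deg_m -{1}(submK le_em) mdegD mdegMn mdeg1 mul1n.
rewrite -{2}(submK le_em) mpolyXD -mpolyXn; apply: reducesM => //.
by rewrite dhomogX.
Qed.

(** * Counting the power products that span the forms on [Z] *)

Section Span.
Context (F : fieldType) (r k : nat) (Z : ('I_r -> F) -> Prop)
  (G : 'I_k.+1 -> {mpoly F[r]}) (t0 : nat).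

(* The exponent of [G ord0] is determined by the other ones: this is what saves
   one power of [s] in the number of generators. *)
Definition power_product (s : nat) (b : 'I_k -> nat) (m : 'X_{1..r}) v : F :=
  \prod_l (G (lift ord0 l)).@[v] ^+ b l * (G ord0).@[v] ^+ (s - \sum_l b l) *
  ('X_[m] : {mpoly F[r]}).@[v].

Definition span_index (s : nat) : finType :=
  ({ffun 'I_k -> 'I_s.+1} * 'X_{1..r < t0.+1})%type.

(** The value [0] where the subtraction in [power_product] would be truncated allows a full product
    as index type, which is easily counted. *)
Definition span_gen (s : nat) (j : span_index s) v : F :=
  if (\sum_l j.1 l <= s)%N then power_product s (fun l => j.1 l) j.2 v else 0.

Definition in_span (s : nat) (phi : ('I_r -> F) -> F) :=
  exists c : span_index s -> F, forall v, Z v -> phi v = \sum_j c j * span_gen j v.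

Lemma eq_in_span s phi psi :
  (forall v, Z v -> phi v = psi v) -> in_span s psi -> in_span s phi.
Proof. by move=> eq_phi [c cP]; exists c => v Zv; rewrite eq_phi ?cP. Qed.

Lemma in_span_sum (I : Type) s (x : seq I) (P : pred I) (a : I -> F) phi :
  (forall i, P i -> in_span s (phi i)) ->
  in_span s (fun v => \sum_(i <- x | P i) a i * phi i v).
Proof.
move=> phiP; elim: x => [|i x [c cP]].
  by exists (fun=> 0) => v _; rewrite big_nil big1 // => j _; rewrite mul0r.
have [Pi|nPi] := boolP (P i); last first.
  by exists c => v Zv; rewrite big_cons (negPf nPi) cP.
have [d dP] := phiP i Pi; exists (fun j => a i * d j + c j) => v Zv.
rewrite big_cons Pi cP // dP // mulr_sumr -big_split /=.
by apply: eq_bigr => j _; rewrite mulrDl mulrA.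
Qed.

Lemma in_span_power_product s (b : 'I_k -> nat) (m : 'X_{1..r}) :
  (\sum_l b l <= s)%N -> (mdeg m <= t0)%N -> in_span s (power_product s b m).
Proof.
move=> le_bs le_mt; have lt_mt : (mdeg m < t0.+1)%N by [].
have le_b l : (b l <= s)%N by apply: leq_trans le_bs; rewrite (bigD1 l) //= leq_addr.
pose j : span_index s := ([ffun l => inord (b l)], BMultinom lt_mt).
have jE l : j.1 l = b l :> nat by rewrite /j /= ffunE inordK // ltnS.
exists (fun i => (i == j)%:R) => v Zv; rewrite (bigD1 j) //= eqxx mul1r.
rewrite big1 ?addr0 => [|i /negPf ->]; last by rewrite mul0r.
rewrite /span_gen (eq_bigr (fun l => b l)) => [|l _]; last exact: jE.
rewrite le_bs /power_product; congr (_ * _ ^+ (_ - _) * _).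
  by apply: eq_bigr => l _; rewrite jE.
by apply: eq_bigr => l _; rewrite jE.
Qed.

Lemma in_span_mulG s l phi :
  in_span s phi -> in_span s.+1 (fun v => (G l).@[v] * phi v).
Proof.
case=> c cP.
apply: (@eq_in_span _ _ (fun v => \sum_j c j * ((G l).@[v] * span_gen j v))).
  by move=> v Zv; rewrite cP // mulr_sumr; apply: eq_bigr => j _; rewrite mulrCA.
apply: in_span_sum => -[b m] _; rewrite /span_gen /=.
have [le_bs|_] := leqP (\sum_l b l) s; last first.
  exists (fun=> 0) => v Zv.
  by rewrite mulr0 big1 // => j _; rewrite mul0r.
have le_mt : (mdeg m <= t0)%N by have := bmdeg m.
have [i ->|->] := unliftP ord0 l.
  pose b' j := (b j + (j == i))%N.
  have sum_b' : (\sum_j b' j = (\sum_j b j).+1)%N.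
    rewrite big_split /= -[RHS]addn1; congr addn; rewrite (bigD1 i) //= eqxx big1 //.
    by move=> j /negPf ->.
  have := @in_span_power_product s.+1 b' m _ le_mt; rewrite sum_b' => /(_ le_bs).
  apply: eq_in_span => v Zv; rewrite /power_product sum_b' subSS !mulrA.
  congr (_ * _ * _); rewrite /b'.
  under [RHS]eq_bigr => j _ do rewrite exprD.
  rewrite big_split mulrC /=; congr (_ * _).
  by rewrite (bigD1 i) //= eqxx expr1 big1 ?mulr1 // => j /negPf ->; rewrite expr0.
(* A factor [G ord0] leaves [b] unchanged: the exponent determined by [s] absorbs it. *)
have := @in_span_power_product s.+1 (fun j => b j) m (leqW le_bs) le_mt.
apply: eq_in_span => v Zv; rewrite /power_product subSn // exprS !mulrA.
by congr (_ * _ * _); rewrite mulrC.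
Qed.

End Span.

(** Each reduction lowers the degree by [D], so that after [s] of them the coefficients are
    combinations of monomials of degree [t0]. *)
Lemma in_span_homog (F : fieldType) (r k D t0 : nat)
    (Z : ('I_r -> F) -> Prop) (G : 'I_k.+1 -> {mpoly F[r]}) :
  (D <= t0)%N ->
  (forall t f, (t0 <= t)%N -> f \is t.-homog -> reduces D Z G t f) ->
  forall s f, f \is (t0 + s * D).-homog -> in_span Z G t0 s (fun v => f.@[v]).
Proof.
move=> le_Dt red; elim=> [|s IHs] f hom_f.
  rewrite addn0 in hom_f.
  apply: (@eq_in_span _ _ _ _ _ _ _ _
            (fun v => \sum_(m <- msupp f | m \in msupp f) f@_m * ('X_[m] : {mpoly F[r]}).@[v])).
    by move=> v _; rewrite {1}[f]mpolyE raddf_sum /= big_seq; apply: eq_bigr => m _; rewrite mevalZ.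
  apply: in_span_sum => m m_f.
  have := @in_span_power_product _ _ _ Z G t0 0 (fun=> 0%N) m.
  rewrite big1 // leqnn (dhomog_mf hom_f m_f) leqnn => /(_ isT isT).
  apply: eq_in_span => v _.
  by rewrite /power_product big1 ?sub0n ?expr0 ?mul1r // => l _; rewrite expr0.
have [g [gP fE]] := red _ _ (leq_addr _ _) hom_f.
apply: (@eq_in_span _ _ _ _ _ _ _ _ (fun v => \sum_l 1 * ((G l).@[v] * (g l).@[v]))).
  by move=> v Zv; rewrite fE //; apply: eq_bigr => l _; rewrite mul1r.
apply: in_span_sum => l _; apply: in_span_mulG; apply: IHs.
by have [] := gP l; rewrite mulSn addnCA addKn.
Qed.

(** The bound counts the generators of the span, [K] being the number of monomials of degree at most
    [t0]; more forms than generators are dependent on [Z]. *)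
Lemma hilbert_upper_bound (F : closedFieldType) (r k D : nat)
    (Z : ('I_r -> F) -> Prop) (G : 'I_k.+1 -> {mpoly F[r]}) :
  uncountable F -> (forall l, G l \is D.-homog) -> (0 < D)%N ->
  (forall u, homog_closure Z u -> (forall l, (G l).@[u] = 0) -> forall i, u i = 0) ->
  exists t0 K, forall s M,
    hilbert_ge Z (t0 + s * D) M -> (M <= s.+1 ^ k * K)%N.
Proof.
move=> uncF homG D_gt0 no_zero.
have [t0 [le_Dt red]] := reduces_of_no_zero uncF homG D_gt0 no_zero.
exists t0, #|{: 'X_{1..r < t0.+1}}| => s M [f [hom_f indep_f]].
have card_index : #|span_index r k t0 s| = (s.+1 ^ k * #|{: 'X_{1..r < t0.+1}}|)%N.
  by rewrite card_prod card_ffun !card_ord.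
rewrite -card_index leqNgt; apply/negP => ltM.
have /fin_all_exists [c cP] := fun i => in_span_homog le_Dt red (hom_f i).
pose A := \matrix_(i < M, j < #|span_index r k t0 s|) c i (enum_val j).
have [d /rV0Pn [i di] dA0] := row_dependence A ltM.
move/eqP: di; apply; apply: (indep_f (d 0)) => v Zv.
under eq_bigr => l _ do rewrite cP // mulr_sumr.
rewrite exchange_big big1 //= => j _.
under eq_bigr => l _ do rewrite mulrA.
rewrite -mulr_suml.
have := congr1 (fun B : 'rV_ _ => B 0 (enum_rank j)) dA0; rewrite !mxE.
under eq_bigr => l _ do rewrite !mxE enum_rankK.
by move->; rewrite mul0r.
Qed.

Lemma leq_expl m n e : (m <= n)%N -> (m ^ e <= n ^ e)%N.
Proof. by case: e => // e; rewrite leq_exp2r. Qed.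

Theorem exists_common_zero (F : closedFieldType) (r k D E : nat)
    (Z : ('I_r -> F) -> Prop) (G : 'I_k -> {mpoly F[r]}) :
  uncountable F -> (forall l, G l \is D.-homog) -> (0 < D)%N -> (0 < k)%N ->
  (forall s t, (E * s <= t)%N -> hilbert_ge Z t (s ^ k)) ->
  exists u, [/\ exists i, u i != 0, homog_closure Z u & forall l, (G l).@[u] = 0].
Proof.
case: k G => // k G uncF homG D_gt0 _ lower; apply: NNPP => no_u.
have [u cl_u Gu i|t0 [K upper]] := hilbert_upper_bound (Z := Z) uncF homG D_gt0.
  apply/eqP; apply: contraT => ui; case: no_u; exists u.
  by split=> //; exists i.
(* The lower bound is used for [q * D] and the upper one for [E * q]; this [q] makes [q ^ k.+1]
   exceed [(E.+1 * q) ^ k * K]. *)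
pose q := (K * E.+1 ^ k).+1.
have /lower/upper: (E * (q * D) <= t0 + E * q * D)%N by rewrite mulnA leq_addl.
apply/negP; rewrite -ltnNge.
have le_Eq : ((E * q).+1 <= E.+1 * q)%N by rewrite mulSn -add1n leq_add2r.
apply: (@leq_ltn_trans ((E.+1 * q) ^ k * K)); first by rewrite leq_mul2r leq_expl ?orbT.
apply: (@leq_trans (q ^ k.+1)); last by rewrite leq_exp2r // leq_pmulr.
rewrite expnMn expnS mulnAC ltn_pmul2r ?expn_gt0 //.
by rewrite /q ltnS mulnC.
Qed.

(** * Uncountability of the complex numbers *)

Lemma uncountable_cancel (T U : eqType) (f : T -> U) (g : U -> T) :
  cancel f g -> uncountable T -> uncountable U.
Proof.
move=> fK uncT L; have [x xL] := uncT (fun m => map g (L m)).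
by exists (f x) => m; apply: contra (xL m) => /(map_f g); rewrite fK.
Qed.

Lemma subinterval_avoid (s : seq Rdefinitions.R) (a b : Rdefinitions.R) : a < b ->
  exists c : Rdefinitions.R * Rdefinitions.R, [/\ a <= c.1, c.1 < c.2, c.2 <= b &
    forall x, x \in s -> x < c.1 \/ c.2 < x].
Proof.
elim: s a b => [|y s IHs] a b lt_ab; first by exists (a, b).
have [a1 [b1 [le_a lt1 le_b y_out]]] : exists a1 b1 : Rdefinitions.R,
    [/\ a <= a1, a1 < b1, b1 <= b & y < a1 \/ b1 < y].
  have [le_y|lt_y] := leP y ((a + b) / 2).
    by exists ((a + 3 * b) / 4), b; split; try lra; left; lra.
  by exists a, ((a + b) / 2); split; try lra; right; lra.
have [[c d] /= [le_c lt_cd le_d out]] := IHs _ _ lt1.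
exists (c, d); split=> //=; [lra | lra |] => x.
rewrite inE => /predU1P[->|/out//].
by case: y_out => lt_y; [left|right]; lra.
Qed.

(** Cantor's nested intervals: the interval chosen at each stage avoids the corresponding list, and
    the supremum of the left endpoints lies in all intervals. *)
Lemma real_uncountable : uncountable Rdefinitions.R.
Proof.
move=> L.
pose itv := {c : Rdefinitions.R * Rdefinitions.R | c.1 < c.2}.
have /ClassicalEpsilon.choice [next nextP] : forall ni : nat * itv, exists j : itv,
    [/\ (sval ni.2).1 <= (sval j).1, (sval j).2 <= (sval ni.2).2 &
     forall x, x \in L ni.1 -> x < (sval j).1 \/ (sval j).2 < x].
  move=> [n [[a b] /= lt_ab]].
  have [c [le_a lt_c le_b out]] := subinterval_avoid (L n) lt_ab.
  by exists (exist _ c lt_c).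
have lt01 : (0 : Rdefinitions.R, 1 : Rdefinitions.R).1 < (0 : Rdefinitions.R, 1 : Rdefinitions.R).2 by rewrite /= ltr01.
pose c := fix c n : itv := if n is m.+1 then next (m, c m) else exist _ (0, 1) lt01.
pose a n := (sval (c n)).1; pose b n := (sval (c n)).2.
have lt_ab n : a n < b n by exact: (svalP (c n)).
have [a_step b_step] : (forall n, a n <= a n.+1) /\ (forall n, b n.+1 <= b n).
  by split=> n; have [] := nextP (n, c n).
have a_mono n m : a n <= a (n + m)%N.
  by elim: m => [|m IHm]; rewrite ?addn0 // addnS (le_trans IHm).
have b_mono n m : b (n + m)%N <= b n.
  by elim: m => [|m IHm]; rewrite ?addn0 // addnS (le_trans (b_step _)).
have a_le_b n m : a n <= b m.
  by rewrite (le_trans (a_mono n m)) // addnC (le_trans (ltW (lt_ab _))).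
have [||x [ub_x lub_x]] := Raxioms.completeness (fun x => exists n, x = a n).
- by exists (b 0%N) => _ [n ->]; apply/RleP.
- by exists (a 0%N), 0%N.
exists x => m; apply/negP => x_in.
have le_ax : a m.+1 <= x by apply/RleP; apply: ub_x; exists m.+1.
have le_xb : x <= b m.+1 by apply/RleP; apply: lub_x => _ [n ->]; apply/RleP.
have [_ _ /(_ x x_in)] := nextP (m, c m); rewrite -/(a m.+1) -/(b m.+1).
by case; lra.
Qed.

Lemma complex_uncountable : uncountable C.
Proof.
have fK : cancel ((fun x => Complex x 0) : Rdefinitions.R -> C) (@complex.Re Rdefinitions.R : C -> Rdefinitions.R) by [].

exact: uncountable_cancel fK real_uncountable.
Qed.

(** * Growth of the Hilbert function along a chain *)

Lemma split_lshift m n (i : 'I_m) : split (lshift n i) = inl i.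
Proof. exact: (unsplitK (inl i)). Qed.

Lemma split_rshift m n (i : 'I_n) : split (rshift m i) = inr i.
Proof. exact: (unsplitK (inr i)). Qed.

Lemma hilbert_ge_subset (F : fieldType) (r : nat) (Y Z : ('I_r -> F) -> Prop) t M :
  (forall v, Y v -> Z v) -> hilbert_ge Y t M -> hilbert_ge Z t M.
Proof.
move=> sYZ [f [hom_f indep]]; exists f; split=> // c c0; apply: indep => v Yv.
exact/c0/sYZ.
Qed.

Lemma hilbert_ge0 (F : fieldType) (r : nat) (Z : ('I_r -> F) -> Prop) t :
  hilbert_ge Z t 0.
Proof. by exists (fun=> 0); split=> [[]|c _ []]. Qed.

Lemma hilbert_ge_leq (F : fieldType) (r : nat) (Z : ('I_r -> F) -> Prop) t M M' :
  (M' <= M)%N -> hilbert_ge Z t M -> hilbert_ge Z t M'.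
Proof.
move=> /subnKC <-; case=> f [hom_f indep].
exists (fun i => f (lshift _ i)); split=> // c c0 i.
pose c' (j : 'I_(M' + (M - M'))) := if split j is inl i then c i else 0.
have <- : c' (lshift _ i) = c i by rewrite /c' split_lshift.
apply: indep => v Zv; rewrite big_split_ord /= [X in _ + X]big1 ?addr0 => [|j _].
  rewrite -[RHS](c0 v Zv); apply: eq_bigr => j _.
  by rewrite /c' split_lshift.
by rewrite /c' split_rshift mul0r.
Qed.

Lemma hilbert_ge_dual (F : fieldType) (r : nat) (Z : ('I_r -> F) -> Prop) t
    (I : finType) (f : I -> {mpoly F[r]}) (P : I -> 'I_r -> F) :
  (forall i, f i \is t.-homog) -> (forall i, Z (P i)) ->
  (forall i j, ((f i).@[P j] != 0) = (i == j)) -> hilbert_ge Z t #|I|.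
Proof.
move=> hom_f ZP dual; exists (fun i => f (enum_val i)); split=> // c c0 i.
have := c0 _ (ZP (enum_val i)); rewrite (bigD1 i) //= big1 => [|j ne_ji].
  by rewrite addr0 => /eqP; rewrite mulf_eq0 -[X in _ || X]negbK dual eqxx orbF => /eqP.
apply/eqP; rewrite mulf_eq0 -[X in _ || X]negbK dual (inj_eq enum_val_inj).
by rewrite ne_ji orbT.
Qed.

(** A combination vanishing on [Z], once restricted to [Y], involves only the forms [f1], whose
    coefficients are therefore zero; [g] being a nonzerodivisor on [Z] then disposes of the
    others. *)
Lemma hilbert_ge_add (F : fieldType) (r : nat) (Y Z : ('I_r -> F) -> Prop) e t
    M1 M2 (g : {mpoly F[r]}) :
  (forall v, Y v -> Z v) -> g \is e.-homog -> (forall v, Y v -> g.@[v] = 0) ->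
  (forall h, h \is t.-homog -> (forall v, Z v -> (g * h).@[v] = 0) ->
     forall v, Z v -> h.@[v] = 0) ->
  hilbert_ge Y (e + t) M1 -> hilbert_ge Z t M2 -> hilbert_ge Z (e + t) (M1 + M2).
Proof.
move=> sYZ hom_g g0 g_reg [f1 [hom1 indep1]] [f2 [hom2 indep2]].
exists (fun i => match split i with inl i1 => f1 i1 | inr i2 => g * f2 i2 end).
split=> [i|c c0]; first by case: (split i) => j //; apply: dhomogM.
have {}c0 v : Z v -> \sum_i c (lshift _ i) * (f1 i).@[v] +
    \sum_i c (rshift _ i) * (g.@[v] * (f2 i).@[v]) = 0.
  move=> Zv; rewrite -[RHS](c0 v Zv) big_split_ord /=; congr (_ + _).
    by apply: eq_bigr => i _; rewrite split_lshift.
  by apply: eq_bigr => i _; rewrite split_rshift mevalM.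
have cl : forall i, c (lshift _ i) = 0.
  apply: indep1 => v Yv; rewrite -[RHS](c0 v (sYZ v Yv)).
  rewrite [X in _ = _ + X]big1 ?addr0 // => i _.
  by rewrite g0 // mul0r mulr0.
have cr : forall i, c (rshift _ i) = 0.
  pose h := \sum_i c (rshift M1 i) *: f2 i.
  have hE v : h.@[v] = \sum_i c (rshift M1 i) * (f2 i).@[v].
    by rewrite raddf_sum; apply: eq_bigr => i _; rewrite /= mevalZ.
  apply: indep2 => v Zv; rewrite -hE; apply: g_reg => // [|u Zu].
    by apply: rpred_sum => i _; apply: rpredZ; apply: hom2.
  rewrite mevalM hE mulr_sumr -[RHS](c0 u Zu) [X in _ = X + _]big1 ?add0r => [|i _].
    by apply: eq_bigr => i _; rewrite mulrCA.
  by rewrite cl mul0r.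
by move=> i; rewrite -(splitK i); case: (split i) => j; [exact: cl | exact: cr].
Qed.

Lemma homogeneousP (N : nat) (f : {mpoly C[N.+1]}) :
  homogeneous f <-> exists d, f \is d.-homog.
Proof. by split=> -[d fd]; exists d; apply/dhomogP. Qed.

Lemma proj_closed_hypersurface (N d : nat) (f : {mpoly C[N.+1]}) :
  f \is d.-homog -> proj_closed (fun v => nonzero_vec v /\ f.@[v] = 0).
Proof.
move=> hom_f; exists (eq f); split=> [_ <-|v]; first by apply/homogeneousP; exists d.
split=> -[nz_v fv]; first by split=> // _ <-.
by split=> //; apply: fv.
Qed.

Lemma proj_closed_nonzero (N : nat) (X : coords N -> Prop) v :
  proj_closed X -> X v -> nonzero_vec v.
Proof. by case=> S [_ XE] /XE[]. Qed.

Lemma proj_closed_closure (N : nat) (X : coords N -> Prop) u :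
  proj_closed X -> nonzero_vec u -> homog_closure X u -> X u.
Proof.
case=> S [homS XE] nz_u cl_u; apply/XE; split=> // f Sf.
have /homogeneousP [d hom_f] := homS f Sf.
by apply: (cl_u d) => // v /XE[_]; apply.
Qed.

(** The hypersurfaces of [g] and [h] cover [X], so one of them contains it: the homogeneous ideal of
    [X] is prime. *)
Lemma proj_irreducible_regular (N d e : nat) (X : coords N -> Prop)
    (g h : {mpoly C[N.+1]}) :
  proj_irreducible X -> g \is d.-homog -> h \is e.-homog ->
  (forall v, X v -> (g * h).@[v] = 0) ->
  (forall v, X v -> g.@[v] = 0) \/ (forall v, X v -> h.@[v] = 0).
Proof.
case=> clX [_ irrX] hom_g hom_h gh0.
have [v Xv|sub|sub] := irrX _ _ (proj_closed_hypersurface hom_g) (proj_closed_hypersurface hom_h).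
- have nz_v := proj_closed_nonzero clX Xv.
  have /eqP := gh0 v Xv; rewrite mevalM mulf_eq0.
  by case/orP=> /eqP; [left|right].
- by left=> v /sub[].
- by right=> v /sub[].
Qed.

(** A form [g] that vanishes on [Ch k] but not on [Ch k.+1] is a nonzerodivisor on the latter, and
    each multiplication by it contributes another [s ^ k] independent forms. *)
Lemma irr_chain_hilbert (N k : nat) (X : coords N -> Prop) Ch :
  irr_chain_in X k Ch ->
  exists E, forall s t, (E * s <= t)%N -> hilbert_ge (Ch k) t (s ^ k).
Proof.
case=> irr strict; elim: k irr strict => [|k IHk] irr strict.
  exists 0%N => s t _; have [[clX [[v Xv] _]] _] := irr 0%N isT.
  have [i vi] := proj_closed_nonzero clX Xv.
  rewrite expn0 -card_unit; apply: (@hilbert_ge_dual _ _ _ _ _ (fun=> 'X_i ^+ t) (fun=> v)) => //.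
    by move=> _; rewrite mpolyXn dhomogX /= mdegMn mdeg1 mul1n.
  by move=> [] []; rewrite rmorphXn /= mevalXU expf_eq0 (negPf vi) andbF eqxx.
have [j le_jk|j lt_jk|E EP] := IHk.
- by apply: irr; apply: leqW.
- by apply: strict; apply: leqW.
have [sub nsub] := strict k (ltnSn k).
have [irrX _] := irr k.+1 (leqnn _).
have [[[S [homS chE]] _] _] := irr k (leqnSn k).
have [g [Sg [v [Xv gv]]]] : exists g, S g /\ exists v, Ch k.+1 v /\ g.@[v] <> 0.
  apply: NNPP => no_g; apply: nsub => v Xv; apply/chE; split.
    exact: proj_closed_nonzero irrX.1 Xv.
  by move=> f Sf; apply: NNPP => fv; apply: no_g; exists f; split=> //; exists v.
have /homogeneousP [e hom_g] := homS g Sg.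
(* Degree [E * s] serves the bound on [Ch k], and [e * s] the [s] multiplications by [g]. *)
exists (E + e)%N => s t le_t.
have lower j t' : (E * s + e * j <= t')%N -> hilbert_ge (Ch k.+1) t' (j * s ^ k).
  elim: j t' => [|j IHj] t' le_t'; first exact: hilbert_ge0.
  have le_et' : (e <= t')%N by apply: leq_trans le_t'; rewrite mulnS addnCA leq_addr.
  rewrite mulSn -(subnKC le_et'); apply: (@hilbert_ge_add _ _ (Ch k) _ _ _ _ _ g) => //.
  - by move=> w /chE[_]; apply.
  - move=> h hom_h gh0; have [g0|//] := proj_irreducible_regular irrX hom_g hom_h gh0.
    by case: gv; apply: g0.
  - by apply: EP; rewrite subnKC // (leq_trans _ le_t') ?leq_addr.
  by apply: IHj; rewrite leq_subRL // -addnCA -mulnS.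
by rewrite expnS; apply: lower; rewrite -mulnDl.
Qed.

(** * The curve section and its Segre product *)

Definition zeros (F : fieldType) (r : nat) (v : 'I_r -> F) := [set i | v i == 0].

Lemma card_zeros_prod (F : fieldType) (r m : nat) (p : 'I_m -> 'I_r -> F) :
  (#|zeros (fun i => \prod_k p k i)%R| <= \sum_k #|zeros (p k)|)%N.
Proof.
elim: m p => [|m IHm] p.
  by rewrite eq_card0 // => i; rewrite inE big_ord0 oner_eq0.
rewrite big_ord_recl; apply: leq_trans (leq_add (leqnn _) (IHm _)).
apply: leq_trans (leq_card_setU _ _).
by apply/subset_leq_card/subsetP => i; rewrite !inE big_ord_recl mulf_eq0.
Qed.

Definition curve_section (N n : nat) (X : coords N -> Prop) (v : coords N) :=
  X v /\ forall l, (l.+1 < n)%N -> (mesym N.+1 C (N.-1 - l)).@[v] = 0.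

Lemma mesym_homog (R : comNzRingType) (r k : nat) : mesym r R k \is k.-homog.
Proof.
rewrite mesymE; apply: rpred_sum => h /eqP card_h.
by rewrite dhomogX /= mdeg_mesym1 card_h.
Qed.

(** Only the monomial of the nonzero coordinates survives: any other set of the same size contains a
    vanishing coordinate. *)
Lemma meval_mesym_neq0 (F : fieldType) (r : nat) (v : 'I_r -> F) :
  (mesym r F (r - #|zeros v|)).@[v] != 0.
Proof.
have cardC : #|~: zeros v| = (r - #|zeros v|)%N.
  by rewrite cardsCs setCK card_ord.
rewrite mesymE raddf_sum /= (bigD1 (~: zeros v)) ?cardC //= big1 ?addr0.
  rewrite mevalX prodf_seq_neq0; apply/allP => i _ /=; rewrite mnmE !inE.
  by case: (v i =P 0) => [_|/eqP vi]; rewrite ?expr0 ?oner_eq0 ?expr1.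
move=> h /andP[/eqP card_h ne_h].
have /subsetPn [i ih zi] : ~~ (h \subset ~: zeros v).
  by apply: contra ne_h => sub_h; rewrite eqEcard sub_h cardC card_h leqnn.
rewrite mevalX (bigD1 i) //= mnmE ih expr1.
by move: zi; rewrite !inE negbK => /eqP->; rewrite mul0r.
Qed.

Lemma curve_section_zeros (N n : nat) (X : coords N -> Prop) v :
  (n <= N)%N -> (forall v, X v -> (#|zeros v| <= n)%N) ->
  curve_section n X v -> (#|zeros v| <= 1)%N.
Proof.
move=> le_nN zX [Xv e0]; have le_zn := zX v Xv; rewrite leqNgt; apply/negP => gt1.
have := meval_mesym_neq0 v.
(* With [z] zeros, [2 <= z <= n], the choice [l = z - 2] meets the degree [N + 1 - z]. *)
rewrite (_ : N.+1 - _ = N.-1 - (#|zeros v| - 2))%N; last by lia.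
by rewrite e0 ?eqxx //; lia.
Qed.

Lemma curve_section_closure (N n : nat) (X : coords N -> Prop) u :
  proj_closed X -> nonzero_vec u -> homog_closure (curve_section n X) u ->
  curve_section n X u.
Proof.
move=> clX nz_u cl_u; split=> [|l lt_ln].
  by apply: proj_closed_closure => // d f hom_f f0; apply: (cl_u d) => // v [/f0].
by apply: (cl_u (N.-1 - l)%N); [exact: mesym_homog | move=> v [_]; apply].
Qed.

Lemma curve_section_point (N n E : nat) (X : coords N -> Prop) (a : C) :
  (0 < n)%N -> (n < N)%N -> proj_closed X ->
  (forall v, X v -> (#|zeros v| <= n)%N) ->
  (forall s t, (E * s <= t)%N -> hilbert_ge X t (s ^ n)) ->
  exists v, [/\ curve_section n X v, v ord0 = a * v ord_max & v ord_max != 0].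
Proof.
move=> n_gt0 lt_nN clX zX lower.
(* A common degree: the factorial is a multiple of every [N - 1 - l], so suitable powers of the
   forms have degree [D] and the same zeros. *)
pose D := (N.+1)`!.
pose G (l : 'I_n) : {mpoly C[N.+1]} :=
  if (l.+1 < n)%N then mesym N.+1 C (N.-1 - l) ^+ (D %/ (N.-1 - l))
  else ('X_ord0 - a *: 'X_ord_max) ^+ D.
have homG l : G l \is D.-homog.
  rewrite /G; case: ifP => [lt_ln|_].
    have dvd : (N.-1 - l %| D)%N by apply: dvdn_fact; lia.
    rewrite -[X in X.-homog](divnK dvd) mulnC; apply: dhomogMn; exact: mesym_homog.
  rewrite -[X in X.-homog]mul1n; apply: dhomogMn.
  by apply: rpredB; rewrite ?rpredZ // dhomogX /= mdeg1.
have [u [nz_u cl_u Gu]] :=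
  exists_common_zero complex_uncountable homG (fact_gt0 _) n_gt0 lower.
have curve_u : curve_section n X u.
  split=> [|l lt_ln]; first exact: proj_closed_closure.
  have /eqP := Gu (Ordinal (ltnW lt_ln)); rewrite /G /= lt_ln rmorphXn expf_eq0.
  by case/andP=> _ /eqP.
have eq_u : u ord0 = a * u ord_max.
  have lt_n : (n.-1 < n)%N by rewrite prednK.
  have /eqP := Gu (Ordinal lt_n); rewrite /G /= prednK // ltnn rmorphXn expf_eq0.
  by rewrite /= mevalB mevalZ !mevalXU subr_eq0 => /andP[_ /eqP].
(* If the last coordinate vanished, so would the first, giving a point of the curve with two
   zeros. *)
exists u; split=> //; apply/eqP => u_max.
have := curve_section_zeros (ltnW lt_nN) zX curve_u; rewrite leqNgt => /negP; apply.
have ne0max : (ord0 : 'I_N.+1) != ord_max by rewrite -val_eqE /=; lia.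
suff: (#|[set (ord0 : 'I_N.+1); ord_max]| <= #|zeros u|)%N by rewrite cards2 ne0max.
apply: subset_leq_card; apply/subsetP => i; rewrite !inE.
by case/orP=> /eqP->; rewrite ?eq_u u_max ?mulr0.
Qed.

Section Segre.
Context (F : fieldType) (N m : nat).

Definition multi_index : finType := {ffun 'I_m -> 'I_N.+1}.

Definition segre (p : 'I_m -> ('I_N.+1 -> F)) : 'I_#|multi_index| -> F :=
  fun w => \prod_k p k ((enum_val w : multi_index) k).

Definition segre_image (Y : ('I_N.+1 -> F) -> Prop) (u : 'I_#|multi_index| -> F) :=
  exists2 p, forall k, Y (p k) & u = segre p.

Lemma segreE p (b : multi_index) : segre p (enum_rank b) = \prod_k p k (b k).
Proof. by rewrite /segre enum_rankK. Qed.

Definition multilinear (a : 'I_m -> 'I_N.+1 -> F) : {mpoly F[#|multi_index|]} :=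
  \sum_(b : multi_index) (\prod_k a k (b k)) *: 'X_(enum_rank b).

Lemma multilinear_homog a : multilinear a \is 1.-homog.
Proof. by apply: rpred_sum => b _; rewrite rpredZ // dhomogX /= mdeg1. Qed.

Lemma meval_multilinear a p :
  (multilinear a).@[segre p] = \prod_k \sum_i a k i * p k i.
Proof.
rewrite bigA_distr_bigA raddf_sum /=; apply: eq_bigr => b _.
by rewrite mevalZ mevalXU segreE big_split.
Qed.

(** Lagrange interpolation on a grid: [t.+1] values of the coordinate ratio in each factor give
    [t.+1 ^ m] points, each singled out by a product of [t] multilinear forms. *)
Lemma segre_image_hilbert (Y : ('I_N.+1 -> F) -> Prop) t :
  uncountable F -> (0 < N)%N ->
  (forall a, exists v, [/\ Y v, v ord0 = a * v ord_max & v ord_max != 0]) ->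
  hilbert_ge (segre_image Y) t (t.+1 ^ m).
Proof.
move=> uncF N_gt0 ptY; have /ClassicalEpsilon.choice [P PP] := ptY.
have [s uniq_s] : exists s : t.+1.-tuple F, uniq s.
  elim: t.+1 => [|k [s uniq_s]]; first by exists [tuple].
  have [a a_notin] := uncountable_avoid s uncF.
  by exists [tuple of a :: s]; rewrite /= a_notin.
have /tuple_uniqP inj_s := uniq_s.
have ne0max : (ord_max : 'I_N.+1) != ord0 by rewrite -val_eqE /= -lt0n.
pose coef (a : F) (i : 'I_N.+1) : F :=
  if i == ord0 then 1 else if i == ord_max then - a else 0.
have coefE a v : \sum_i coef a i * v i = v ord0 - a * v ord_max.
  rewrite (bigD1 ord0) //= (bigD1 ord_max) //= big1 ?addr0.
    by rewrite /coef eqxx (negPf ne0max) eqxx mul1r mulNr.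
  by move=> i /andP[/negPf i0 /negPf i1]; rewrite /coef i0 i1 mul0r.
(* The indices [lift (I k) j] run through all those other than [I k], so [f I] vanishes at every
   grid point [Q J] with [J != I]. *)
pose f (I : {ffun 'I_m -> 'I_t.+1}) : {mpoly F[#|multi_index|]} :=
  \prod_(j < t) multilinear (fun k => coef (tnth s (lift (I k) j))).
pose Q (J : {ffun 'I_m -> 'I_t.+1}) := segre (fun k => P (tnth s (J k))).
have -> : (t.+1 ^ m)%N = #|{ffun 'I_m -> 'I_t.+1}| by rewrite card_ffun !card_ord.
apply: (@hilbert_ge_dual _ _ _ _ _ f Q) => [I|J|I J].
- have : forall k (g : 'I_k -> {mpoly F[#|multi_index|]}),
      (forall j, g j \is 1.-homog) -> \prod_(j < k) g j \is k.-homog.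
    elim=> [|k IHk] g hom_g; first by rewrite big_ord0 dhomog1.
    by rewrite big_ord_recl; apply: (@dhomogM _ _ _ 1 _ k) => //; apply: IHk.
  by apply=> j; apply: multilinear_homog.
- by exists (fun k => P (tnth s (J k))) => // k; have [] := PP (tnth s (J k)).
have -> : (f I).@[Q J] = \prod_(j < t) \prod_k
    ((tnth s (J k) - tnth s (lift (I k) j)) * P (tnth s (J k)) ord_max).
  rewrite rmorph_prod; apply: eq_bigr => j _; rewrite /= meval_multilinear.
  apply: eq_bigr => k _; rewrite coefE.
  by have [_ -> _] := PP (tnth s (J k)); rewrite mulrBl.
apply/idP/eqP => [nz|<-].
  apply/ffunP => k; apply/eqP; apply: contraT => ne_IJ.
  have [j|eqIJ] := unliftP (I k) (J k); last by rewrite eqIJ eqxx in ne_IJ.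
  move=> eqJ; case/negP: nz; rewrite (bigD1 j) //= (bigD1 k) //= -eqJ subrr.
  by rewrite !mul0r.
rewrite prodf_seq_neq0; apply/allP => j _; rewrite /= prodf_seq_neq0.
apply/allP => k _ /=; rewrite mulf_neq0 //; last by have [] := PP (tnth s (I k)).
by rewrite subr_eq0 (inj_eq inj_s) neq_lift.
Qed.

Lemma meval_homog_scale (R : comNzRingType) (r d : nat) (f : {mpoly R[r]}) c v :
  f \is d.-homog -> f.@[fun i => c * v i] = c ^+ d * f.@[v].
Proof.
move=> hom_f; rewrite !mevalE mulr_sumr big_seq [RHS]big_seq.
apply: eq_bigr => b b_f; rewrite mulrCA; congr (_ * _).
under eq_bigr => i _ do rewrite exprMn.
rewrite big_split /=; congr (_ * _).
by rewrite -(dhomog_mf hom_f b_f) /= mdegE; elim/big_rec2: _ => // i x y _ ->; rewrite exprD.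
Qed.

Lemma comp_mpolyX_homog (R : comNzRingType) (r r' d : nat) (f : {mpoly R[r]})
    (h : 'I_r -> 'I_r') :
  f \is d.-homog -> f \mPo [tuple 'X_(h i) | i < r] \is d.-homog.
Proof.
move=> hom_f; rewrite comp_mpolyEX big_seq; apply: rpred_sum => b b_f.
apply: rpredZ; rewrite comp_mpolyX.
under eq_bigr => i _ do rewrite tnth_mktuple mpolyXn.
by rewrite mprodXE dhomogX /= mdeg_sum -(dhomog_mf hom_f b_f) /= mdegE;
   apply/eqP/eq_bigr => i _; rewrite mdegMn mdeg1 mul1n.
Qed.

Definition upd (b : multi_index) (k : 'I_m) (j : 'I_N.+1) : multi_index :=
  [ffun k' => if k' == k then j else b k'].

Lemma segre_upd p b k j :
  segre p (enum_rank (upd b k j)) = (\prod_(k' | k' != k) p k' (b k')) * p k j.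
Proof.
rewrite segreE (bigD1 k) //= ffunE eqxx mulrC; congr (_ * _).
by apply: eq_bigr => k' /negPf ne; rewrite ffunE ne.
Qed.

(** For each [k], both sides contain [p k (b k)] once and [m.-1] copies of [p k (b0 k)]. *)
Lemma segre_prod_upd p (b b0 : multi_index) : (0 < m)%N ->
  \prod_k segre p (enum_rank (upd b0 k (b k))) =
  segre p (enum_rank b) * segre p (enum_rank b0) ^+ m.-1.
Proof.
move=> m_gt0; rewrite !segreE -prodrXl -big_split /=.
under eq_bigr => k _ do rewrite segreE.
rewrite exchange_big /=; apply: eq_bigr => k _.
rewrite (bigD1 k) //= ffunE eqxx; congr (_ * _).
rewrite (eq_bigr (fun=> p k (b0 k))) => [|i ne_ik]; last first.
  by rewrite ffunE eq_sym (negPf ne_ik).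
by rewrite prodr_const cardC1 card_ord.
Qed.

(* The relation [segre_prod_upd] alone recovers a point of the closure from the
   coordinates differing from a nonzero one in a single position. *)
Lemma segre_image_closure (Y : ('I_N.+1 -> F) -> Prop) u : (0 < m)%N ->
  (forall v, (exists i, v i != 0) -> homog_closure Y v -> Y v) ->
  (exists w, u w != 0) -> homog_closure (segre_image Y) u ->
  exists p c, [/\ c != 0, forall k, Y (p k) &
    forall b, u (enum_rank b) = c * \prod_k p k (b k)].
Proof.
move=> m_gt0 clY [w0 uw0] cl_u.
pose b0 : multi_index := enum_val w0.
have ub0 : u (enum_rank b0) != 0 by rewrite /b0 enum_valK.
pose p k j := u (enum_rank (upd b0 k j)).
exists p, ((u (enum_rank b0) ^+ m.-1)^-1); split.
- by rewrite invr_neq0 // expf_neq0.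
- move=> k; apply: clY => [|d f hom_f f0].
    exists (b0 k); rewrite /p (_ : upd _ _ _ = b0) //; apply/ffunP => k'.
    by rewrite ffunE; case: eqP => [->|].
  (* On a Segre point these coordinates are a multiple of its [k]-th factor [q k], so [f] composed
     with the substitution vanishes on the image. *)
  pose h j := enum_rank (upd b0 k j).
  have := cl_u _ _ (comp_mpolyX_homog h hom_f).
  rewrite comp_mpoly_meval => <-.
    by apply: meval_eq => j; rewrite tnth_mktuple mevalXU.
  move=> _ [q Yq ->]; rewrite comp_mpoly_meval.
  rewrite (meval_eq (v2 := fun j => (\prod_(k' | k' != k) q k' (b0 k')) * q k j)).
    by rewrite (meval_homog_scale _ _ hom_f) f0 ?mulr0.
  by move=> j; rewrite tnth_mktuple mevalXU segre_upd.
move=> b; apply: (mulfI (expf_neq0 m.-1 ub0)); rewrite mulVKf ?expf_neq0 //.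
pose rel : {mpoly F[#|multi_index|]} :=
  'X_(enum_rank b) * 'X_(enum_rank b0) ^+ m.-1 -
  \prod_k 'X_(enum_rank (upd b0 k (b k))).
have relE v : rel.@[v] = v (enum_rank b) * v (enum_rank b0) ^+ m.-1 -
    \prod_k v (enum_rank (upd b0 k (b k))).
  rewrite mevalB mevalM rmorphXn rmorph_prod /= !mevalXU; congr (_ - _).
  by apply: eq_bigr => k _; rewrite mevalXU.
have hom_rel : rel \is m.-homog.
  apply: rpredB.
    by rewrite mpolyXn -mpolyXD dhomogX /= mdegD mdegMn !mdeg1 mul1n add1n prednK.
  rewrite mprodXE dhomogX /= mdeg_sum.
  by under eq_bigr => i _ do rewrite mdeg1; rewrite sum1_card card_ord.
have : rel.@[u] = 0.
  by apply: (cl_u _ _ hom_rel) => _ [q _ ->]; rewrite relE segre_prod_upd // subrr.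
by move/eqP; rewrite relE subr_eq0 mulrC => /eqP.
Qed.

End Segre.

(** * Decomposition of a point into [N] points of the curve section *)

Theorem mainTheorem2 (N n : nat) (X : coords N -> Prop) :
  irr_proj_variety X n -> (1 <= n)%N -> (n.*2 <= N)%N ->
  (forall v, X v -> ~ Delta (N - n - 1) v) ->
  forall q : coords N, nonzero_vec q -> Hrk_le X q N.
Proof.
move=> [[clX _] [[Ch chainX] _]] n_gt0 le_nN avoid q nz_q.
have lt_nN : (n < N)%N by lia.
have N_gt0 : (0 < N)%N by lia.
have zX v : X v -> (#|zeros v| <= n)%N.
  (* [Delta (N - n - 1)] allows [N - n] nonzero coordinates, which amounts to at least [n + 1]
     zeros. *)
  move=> Xv; rewrite leqNgt; apply/negP => gt_n; apply: (avoid v Xv); split.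
    exact: proj_closed_nonzero clX Xv.
  have := cardsC (zeros v); rewrite card_ord.
  rewrite (_ : ~: zeros v = [set j | v j != 0]); last by apply/setP => i; rewrite !inE.
  move=> eq_card; apply: (@leq_trans (N.+1 - #|zeros v|)); last by lia.
  by have := congr1 (subn^~ #|zeros v|) eq_card; rewrite /= addKn => <-.
have [E lowerCh] := irr_chain_hilbert chainX.
have lower s t : (E * s <= t)%N -> hilbert_ge X t (s ^ n).
  by move/lowerCh; apply: hilbert_ge_subset; have [] := chainX.1 n (leqnn n).
pose Y := curve_section n X.
have ptY a := curve_section_point a n_gt0 lt_nN clX zX lower.
have lowerY s t : (1 * s <= t)%N -> hilbert_ge (@segre_image C N N Y) t (s ^ N).
  rewrite mul1n => le_st; apply: hilbert_ge_leq (segre_image_hilbert N t complex_uncountable N_gt0 ptY).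
  by apply: leq_expl; apply: leqW.
have [i0 qi0] := nz_q.
pose diag i : 'I_#|multi_index N N| := enum_rank ([ffun=> i] : multi_index N N).
(* These [N] equations make the diagonal coordinates a multiple of [q], as [q i0 != 0]; that the
   multiple is not zero is shown separately. *)
pose G l : {mpoly C[#|multi_index N N|]} :=
  q i0 *: 'X_(diag (lift i0 l)) - q (lift i0 l) *: 'X_(diag i0).
have homG l : G l \is 1.-homog.
  by apply: rpredB; rewrite rpredZ // dhomogX /= mdeg1.
have [u [nz_u cl_u Gu]] :=
  exists_common_zero complex_uncountable homG (ltn0Sn 0) N_gt0 lowerY.
have clY v : nonzero_vec v -> homog_closure Y v -> Y v.
  exact: curve_section_closure.
have [p [c [c_neq0 Yp uE]]] := segre_image_closure N_gt0 clY nz_u cl_u.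
have {}uE i : u (diag i) = c * \prod_k p k i.
  by rewrite uE; congr (_ * _); apply: eq_bigr => k _; rewrite ffunE.
have quE i : q i0 * u (diag i) = q i * u (diag i0).
  have [l ->|->//] := unliftP i0 i.
  by have /eqP := Gu l; rewrite mevalB !mevalZ !mevalXU subr_eq0 => /eqP.
(* Each of the [N] factors has at most one zero coordinate, so the product cannot vanish at all
   [N + 1] places. *)
have [i ui] : exists i, u (diag i) != 0.
  have zp : (#|zeros (fun i => \prod_k p k i)%R| <= N)%N.
    apply: leq_trans (card_zeros_prod p) _; rewrite -[X in (_ <= X)%N]card_ord -sum1_card.
    by apply: leq_sum => k _; apply: curve_section_zeros (ltnW lt_nN) zX (Yp k).
  have /subsetPn [i _ zi] : ~~ ([set: 'I_N.+1] \subset zeros (fun i => \prod_k p k i)).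
    by apply: contraL zp => /subset_leq_card; rewrite cardsT card_ord -ltnNge.
  by exists i; rewrite uE mulf_neq0 //; rewrite inE in zi.
have ui0 : u (diag i0) != 0.
  apply: contraNneq ui => ui0; have /eqP := quE i.
  by rewrite ui0 mulr0 mulf_eq0 (negPf qi0).
exists N; split=> //; split=> //; exists p; split=> [k|]; first by case: (Yp k).
split=> //; exists (q i0 * c / u (diag i0)); split=> [|j].
  by rewrite !mulf_neq0 ?invr_neq0.
apply: (mulIf ui0); rewrite -quE uE /hadamard; field.
exact: ui0.
Qed.
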